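(* The Hessian matrix (with respect to $z\in\mathbb{R}^8$) of the function $\sqrt{2I}\,U$ at the point $z_0=(2,0,0,2,-2,0,0,-2)$ has, counted with multiplicity, the eight eigenvalues $$0,\quad 0,\quad \frac{3}{8},\quad \frac{3\sqrt2}{4},\quad \frac{\sqrt2}{4}+\frac18,\quad \frac{\sqrt2}{4}+\frac18,\quad \frac{\sqrt2}{2}+\frac18,\quad \frac{\sqrt2}{2}+\frac18 .$$
   Context: Consider the planar Newtonian 4-body problem with four masses all equal to $1$, at positions $(x_i,y_i)\in\mathbb{R}^2$, $i=1,\dots,4$. Write $z=(x_1,y_1,x_2,y_2,x_3,y_3,x_4,y_4)\in\mathbb{R}^8$, and let $$I(z)=\frac12\sum_{i=1}^4 (x_i^2+y_i^2),\qquad U(z)=\sum_{1\le i<j\le 4}\frac{1}{\sqrt{(x_i-x_j)^2+(y_i-y_j)^2}} .$$ The point $z_0=(2,0,0,2,-2,0,0,-2)$ (the square central configuration) is a critical point of $\sqrt{2I}\,U$. The Hessian is the ordinary $8\times 8$ matrix of second partial derivatives $\partial^2(\sqrt{2I}\,U)/\partial z^2$. *)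

(* Defs.v *)
From mathcomp Require Import all_boot all_order all_algebra.
From mathcomp Require Import all_classical all_reals all_analysis.

Set Implicit Arguments.
Unset Strict Implicit.
Unset Printing Implicit Defensive.

Import Order.TTheory GRing.Theory Num.Theory.
Import numFieldNormedType.Exports.

Local Open Scope classical_set_scope.
Local Open Scope ring_scope.

Section Hessian.
Variables (R : realType) (n : nat).
Implicit Types (f : 'rV[R]_n.+1 -> R) (z : 'rV[R]_n.+1).

Definition basis_vec (j : 'I_n.+1) : 'rV[R]_n.+1 := delta_mx 0 j.

Definition partial (j : 'I_n.+1) f : 'rV[R]_n.+1 -> R :=
  fun z => 'D_(basis_vec j) f z.

Definition hessian f z : 'M[R]_n.+1 :=
  \matrix_(i, j) partial i (partial j f) z.

(* ['D_v f z] takes a junk value when the limit does not exist; this predicate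
   says that every entry of [hessian f z] is a genuine second partial. *)
Definition has_hessian f z : Prop :=
  (\forall w \near z, forall j, derivable f w (basis_vec j)) /\
  (forall i j, derivable (partial j f) z (basis_vec i)).

End Hessian.

Section FourBody.
Variable R : realType.
Implicit Type z : 'rV[R]_8.

(* z = (x_1, y_1, ..., x_4, y_4), with the bodies numbered from 0. *)
Definition xpos z (i : 'I_4) : R := z 0 (inord (2 * i)%N).
Definition ypos z (i : 'I_4) : R := z 0 (inord (2 * i + 1)%N).

Definition inertia z : R :=
  2^-1 * \sum_(i < 4) (xpos z i ^+ 2 + ypos z i ^+ 2).

Definition potential z : R :=
  \sum_(i < 4) \sum_(j < 4 | (i < j)%N)
    1 / Num.sqrt ((xpos z i - xpos z j) ^+ 2 + (ypos z i - ypos z j) ^+ 2).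

Definition sqrt2IU z : R := Num.sqrt (2 * inertia z) * potential z.

Definition square_config : 'rV[R]_8 :=
  \row_(k < 8) [:: 2; 0; 0; 2; -2; 0; 0; -2]`_k.

End FourBody.

(* Main.v *)
Require Import Defs.
From mathcomp Require Import all_boot all_order all_algebra ring.
From mathcomp Require Import all_classical all_reals all_analysis.

Import Order.TTheory GRing.Theory Num.Theory.
Import numFieldNormedType.Exports.

Set Implicit Arguments.
Unset Strict Implicit.

Local Open Scope ring_scope.

(** Write r_0 = sqrt (2 I) and let r_ij be the mutual distances; the function is
    r_0 times the sum of the 1 / r_ij.  All of r_0 ^ 2, r_ij ^ 2 are quadratic
    forms, so explicit first and second derivatives are obtained from three
    rules: sums, products, and composition with a function of one real
    variable, here sqrt and its reciprocal ([deriv2_comp], [deriv2_sqrt],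
    [deriv2_isqrt]).  Away from collisions this gives the second derivative as
    an explicit bilinear form ([deriv2_sqrt2IU]).

    At the square, 2 I = 16 and the squared distances are 8 (sides) and 16
    (diagonals), so the form has coefficients affine in sqrt 2.  Its
    eigenvectors are found from the symmetry of the square: the dilation and
    the rotation (eigenvalue 0, since the function is invariant under both and
    the square is a critical point), two one-dimensional modes that deform the
    square into a rhombus or a rectangle, the two translations, and a
    two-dimensional mode in which opposite bodies move together, against the
    other pair.  All eight have coordinates 0, 1 or -1, exactly four of them
    nonzero, and are pairwise orthogonal ([mode_mx_orthogonal]).  The form
    equals the sum over the modes m_k of (lambda_k / 4) m_k(u) m_k(v), an
    identity of polynomials in the coordinates of u and v
    ([ddsqrt2IU_square]), and the characteristic polynomial follows by
    conjugation ([char_poly_orthogonal_conj]). *)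

(** * Second directional derivatives *)

Section SecondDerivatives.
Variables (R : realType) (V : normedModType R).
Implicit Types (f g : V -> R) (df dg : V -> V -> R).
Implicit Types (ddf ddg : V -> V -> V -> R) (D : set V) (u v w : V).

(** Reduces directional derivatives to derivatives on the real line, where the
    chain rule is available. *)
Lemma is_derive_line f w v (a : R) :
  is_derive w v f a <-> is_derive (0 : R) 1 (fun h : R => f (h *: v + w)) a.
Proof.
have E : (fun h : R => h^-1 *: ((f \o shift w) (h *: v) - f w)) =
    (fun h : R => h^-1 *: (((fun h : R => f (h *: v + w)) \o shift 0) (h *: 1)
       - f (0 *: v + w))).
  by apply/funext => h /=; rewrite scale0r add0r addr0 [h%:A]mulr1.
split=> -[dfw <-]; apply: DeriveDef; first exact: (derivable1P f w v).1.
- by rewrite /derive E.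
- exact: (derivable1P f w v).2.
- by rewrite /derive E.
Qed.

Lemma is_derive_chain f w v (a b : R) (g : R -> R) :
  is_derive w v f a -> is_derive (f w) 1 g b ->
  is_derive w v (g \o f) (b * a).
Proof.
move=> /is_derive_line fw gw; apply/is_derive_line.
by apply: (is_derive1_comp (f := g) (x := 0)) => //; rewrite scale0r add0r.
Qed.

(** Here [df w v] and [ddf w u v] are the first and second derivatives at [w] in
    the directions [v], then [u].  Asking for them on a whole set [D] makes the
    property stable under products and compositions. *)
Definition deriv2_on D f df ddf :=
  forall w, D w ->
    (forall v, is_derive w v f (df w v)) /\
    (forall u v, is_derive w u (df ^~ v) (ddf w u v)).

Lemma deriv2_eq D f df ddf f' df' ddf' : deriv2_on D f df ddf ->
  f = f' -> (forall w v, df w v = df' w v) ->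
  (forall w u v, ddf w u v = ddf' w u v) -> deriv2_on D f' df' ddf'.
Proof.
move=> Df <- e1 e2.
have <- : df = df' by apply/funext => w; apply/funext => v; exact: e1.
suff <- : ddf = ddf' by [].
by do 3![apply/funext => ?]; exact: e2.
Qed.

Lemma deriv2D D f df ddf g dg ddg :
  deriv2_on D f df ddf -> deriv2_on D g dg ddg ->
  deriv2_on D (fun w => f w + g w) (fun w v => df w v + dg w v)
    (fun w u v => ddf w u v + ddg w u v).
Proof.
move=> Df Dg w /[dup] /Df[f1w f2w] /Dg[g1w g2w].
by split=> *; apply: is_deriveD.
Qed.

Lemma deriv2_sum D (I : Type) (r : seq I) (P : pred I) F F1 F2 :
  (forall i, P i -> deriv2_on D (F i) (F1 i) (F2 i)) ->
  deriv2_on D (fun w => \sum_(i <- r | P i) F i w)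
    (fun w v => \sum_(i <- r | P i) F1 i w v)
    (fun w u v => \sum_(i <- r | P i) F2 i w u v).
Proof.
move=> DF; elim: r => [|i r IHr].
  apply: (@deriv2_eq D (cst 0) (fun _ _ => 0) (fun _ _ _ => 0)).
  - by move=> w _; split=> *; exact: is_derive_cst.
  - by apply/funext => w; rewrite big_nil.
  - by move=> *; rewrite big_nil.
  - by move=> *; rewrite big_nil.
case: (boolP (P i)) => Pi.
  apply: (deriv2_eq (deriv2D (DF i Pi) IHr)).
  - by apply/funext => w; rewrite big_cons Pi.
  - by move=> *; rewrite big_cons Pi.
  - by move=> *; rewrite big_cons Pi.
apply: (deriv2_eq IHr).
- by apply/funext => w; rewrite big_cons (negPf Pi).
- by move=> *; rewrite big_cons (negPf Pi).
- by move=> *; rewrite big_cons (negPf Pi).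
Qed.

Lemma deriv2M D f df ddf g dg ddg :
  deriv2_on D f df ddf -> deriv2_on D g dg ddg ->
  deriv2_on D (fun w => f w * g w) (fun w v => df w v * g w + f w * dg w v)
    (fun w u v => ddf w u v * g w + df w v * dg w u
                + df w u * dg w v + f w * ddg w u v).
Proof.
move=> Df Dg w /[dup] /Df[f1w f2w] /Dg[g1w g2w]; split=> [v|u v].
  by apply: is_derive_eq; rewrite /GRing.scale /=; ring.
have H := is_deriveD (is_deriveM (f2w u v) (g1w u))
                     (is_deriveM (f1w u) (g2w u v)).
by apply: (is_derive_eq H); rewrite /GRing.scale /=; ring.
Qed.

Lemma deriv2_comp D f df ddf (h h1 h2 : R -> R) : deriv2_on D f df ddf ->
  (forall w, D w -> is_derive (f w) 1 h (h1 (f w))) ->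
  (forall w, D w -> is_derive (f w) 1 h1 (h2 (f w))) ->
  deriv2_on D (fun w => h (f w)) (fun w v => h1 (f w) * df w v)
    (fun w u v => h2 (f w) * df w u * df w v + h1 (f w) * ddf w u v).
Proof.
move=> Df hh1 hh2 w Dw; have [f1w f2w] := Df w Dw; split=> [v|u v].
  exact: (is_derive_chain (f1w v) (hh1 w Dw)).
have dh1 := is_derive_chain (f1w u) (hh2 w Dw).
apply: (is_derive_eq (is_deriveM dh1 (f2w u v))).
by rewrite /GRing.scale /=; ring.
Qed.

End SecondDerivatives.

(** * The functions sqrt and 1 / sqrt *)

Section SquareRoot.
Variable R : realType.
Implicit Type t : R.

(** The derivatives of sqrt and of [isqrt], of any order, are constant multiples
    of powers of [isqrt]. *)
Definition isqrt t : R := (Num.sqrt t)^-1.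

Lemma is_derive_sqrt t : 0 < t -> is_derive t 1 Num.sqrt (isqrt t / 2).
Proof.
move=> t0; apply: is_derive_eq; first exact: is_derive1_sqrt.
by rewrite /isqrt invfM mulrC.
Qed.

Lemma is_derive_isqrt t : 0 < t -> is_derive t 1 isqrt (- (isqrt t ^+ 3) / 2).
Proof.
move=> t0; have s0 : Num.sqrt t != 0 by rewrite gt_eqF // sqrtr_gt0.
apply: is_derive_eq; first exact: (is_deriveV s0 (is_derive1_sqrt t0)).
by rewrite /GRing.scale /= /isqrt; field.
Qed.

Lemma is_derive_sqrt2 t : 0 < t ->
  is_derive t 1 (fun t => isqrt t / 2) (- (isqrt t ^+ 3) / 4).
Proof.
move=> /is_derive_isqrt dt.
have H := is_deriveM dt (is_derive_cst (2^-1 : R) t 1).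
by apply: (is_derive_eq H); rewrite /GRing.scale /=; field.
Qed.

Lemma is_derive_isqrt2 t : 0 < t ->
  is_derive t 1 (fun t => - (isqrt t ^+ 3) / 2) (3 / 4 * isqrt t ^+ 5).
Proof.
move=> /is_derive_isqrt dt.
have H := is_deriveM (is_deriveN (is_deriveX 3 dt))
  (is_derive_cst (2^-1 : R) t 1).
by apply: (is_derive_eq H); rewrite /GRing.scale /=; field.
Qed.

End SquareRoot.

(** * Square roots of quadratic forms *)

Section QuadraticForms.
Variables (R : realType) (V : normedModType R).
Implicit Types (l q : V -> R) (b : V -> V -> R) (D : set V).

Definition linear_on D l :=
  deriv2_on D l (fun _ v => l v) (fun _ _ _ => 0).

(** The derivatives of the quadratic form [q w = b w w] when [b] is a symmetric
    bilinear form. *)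
Definition quadratic_on D q b :=
  deriv2_on D q (fun w v => 2 * b w v) (fun _ u v => 2 * b u v).

Lemma linear_onB D l1 l2 :
  linear_on D l1 -> linear_on D l2 -> linear_on D (fun w => l1 w - l2 w).
Proof.
move=> Dl1 Dl2 w /[dup] /Dl1[d1 dd1] /Dl2[d2 dd2].
split=> [v|u v]; first exact: is_deriveB.
exact: is_derive_cst.
Qed.

Lemma quadratic_sqr D l :
  linear_on D l -> quadratic_on D (fun w => l w ^+ 2) (fun u v => l u * l v).
Proof.
by move=> Dl; apply: (deriv2_eq (deriv2M Dl Dl)) => // *; ring.
Qed.

Lemma quadraticD D q b q' b' : quadratic_on D q b -> quadratic_on D q' b' ->
  quadratic_on D (fun w => q w + q' w) (fun u v => b u v + b' u v).
Proof.
by move=> Dq Dq'; apply: (deriv2_eq (deriv2D Dq Dq')) => // *; rewrite mulrDr.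
Qed.

Lemma quadratic_sum D (I : Type) (r : seq I) (P : pred I) Q B :
  (forall i, P i -> quadratic_on D (Q i) (B i)) ->
  quadratic_on D (fun w => \sum_(i <- r | P i) Q i w)
    (fun u v => \sum_(i <- r | P i) B i u v).
Proof.
by move=> DQ; apply: (deriv2_eq (deriv2_sum r DQ)) => // *; rewrite mulr_sumr.
Qed.

Lemma deriv2_sqrt D q b : quadratic_on D q b -> (forall w, D w -> 0 < q w) ->
  deriv2_on D (fun w => Num.sqrt (q w))
    (fun w v => isqrt (q w) * b w v)
    (fun w u v => isqrt (q w) * b u v - isqrt (q w) ^+ 3 * b w u * b w v).
Proof.
move=> Dq q0; have H := deriv2_comp (h2 := fun t => - (isqrt t ^+ 3) / 4) Dq
  (fun w Dw => is_derive_sqrt (q0 w Dw))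
  (fun w Dw => is_derive_sqrt2 (q0 w Dw)).
by apply: (deriv2_eq H) => // *; field.
Qed.

Lemma deriv2_isqrt D q b : quadratic_on D q b -> (forall w, D w -> 0 < q w) ->
  deriv2_on D (fun w => isqrt (q w))
    (fun w v => - (isqrt (q w) ^+ 3 * b w v))
    (fun w u v => 3 * isqrt (q w) ^+ 5 * b w u * b w v
                  - isqrt (q w) ^+ 3 * b u v).
Proof.
move=> Dq q0; have H := deriv2_comp (h1 := fun t => - (isqrt t ^+ 3) / 2)
  (h2 := fun t => 3 / 4 * isqrt t ^+ 5) Dq
  (fun w Dw => is_derive_isqrt (q0 w Dw))
  (fun w Dw => is_derive_isqrt2 (q0 w Dw)).
by apply: (deriv2_eq H) => // *; field.
Qed.

End QuadraticForms.

(** * The Hessian matrix and the second derivative *)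

Section HessianForm.
Variables (R : realType) (n : nat).
Implicit Types (f : 'rV[R]_n.+1 -> R) (D : set 'rV[R]_n.+1).

(** The second partials differentiate the function [partial j f], which is known
    to agree with [df] on [D] only; hence [D] has to be a neighbourhood. *)
Lemma hessian_deriv2 D f df ddf z : deriv2_on D f df ddf ->
  (\forall w \near z, D w) ->
  has_hessian f z /\
  hessian f z = \matrix_(i, j) ddf z (basis_vec R i) (basis_vec R j).
Proof.
move=> Df Dz.
have Dpartial i j : is_derive z (basis_vec R i) (partial j f)
    (ddf z (basis_vec R i) (basis_vec R j)).
  apply: near_eq_is_derive ((Df z (nbhs_singleton Dz)).2 _ _).
  near=> w; have Dw : D w by near: w.
  by have [/(_ (basis_vec R j))[_ <-] _] := Df w Dw.
split; first split.
- near=> w => j; have Dw : D w by near: w.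
  by have [/(_ (basis_vec R j))[]] := Df w Dw.
- by move=> i j; have [] := Dpartial i j.
- by apply/matrixP => i j; rewrite !mxE; have [_ <-] := Dpartial i j.
Unshelve. all: by end_near. Qed.

Lemma linear_on_coord D (k : 'I_n.+1) :
  linear_on D (fun z : 'rV[R]_n.+1 => z 0 k).
Proof.
move=> w _; split=> [v|u v]; last exact: is_derive_cst.
apply/is_derive_line.
have -> : (fun h : R => (h *: v + w) 0 k) = (fun h : R => h * v 0 k + w 0 k).
  by apply/funext => h; rewrite !mxE.
have H := is_deriveD (is_deriveM (is_derive_id (0 : R) 1)
  (is_derive_cst (v 0 k) (0 : R) 1)) (is_derive_cst (w 0 k) (0 : R) 1).
by apply: (is_derive_eq H); rewrite /GRing.scale /=; ring.
Qed.

End HessianForm.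

(** * The function sqrt (2 I) U away from collisions *)

Section FourBodyDerivatives.
Variable R : realType.
Implicit Types z u v w : 'rV[R]_8.

Definition size2 z : R := \sum_(i < 4) (xpos z i ^+ 2 + ypos z i ^+ 2).
Definition dot u v : R :=
  \sum_(i < 4) (xpos u i * xpos v i + ypos u i * ypos v i).

Definition dist2 (i j : 'I_4) z : R :=
  (xpos z i - xpos z j) ^+ 2 + (ypos z i - ypos z j) ^+ 2.
(** The polar form of [dist2 i j]. *)
Definition reldot (i j : 'I_4) u v : R :=
  (xpos u i - xpos u j) * (xpos v i - xpos v j) +
  (ypos u i - ypos u j) * (ypos v i - ypos v j).

Definition collision_free : set 'rV[R]_8 :=
  [set z | 0 < size2 z /\ forall i j : 'I_4, (i < j)%N -> 0 < dist2 i j z]%classic.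

Lemma quadratic_size2 D : quadratic_on D size2 dot.
Proof.
apply: quadratic_sum => i _; apply: quadraticD; apply: quadratic_sqr;
  exact: linear_on_coord.
Qed.

Lemma quadratic_dist2 D i j : quadratic_on D (dist2 i j) (reldot i j).
Proof.
by apply: quadraticD; apply: quadratic_sqr; apply: linear_onB;
  exact: linear_on_coord.
Qed.

Definition dpotential z v : R := \sum_(i < 4) \sum_(j < 4 | (i < j)%N)
  - (isqrt (dist2 i j z) ^+ 3 * reldot i j z v).
Definition ddpotential z u v : R := \sum_(i < 4) \sum_(j < 4 | (i < j)%N)
  (3 * isqrt (dist2 i j z) ^+ 5 * reldot i j z u * reldot i j z v
   - isqrt (dist2 i j z) ^+ 3 * reldot i j u v).

Lemma deriv2_potential :
  deriv2_on collision_free (@potential R) dpotential ddpotential.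
Proof.
have H := deriv2_sum (index_enum 'I_4) (fun i _ => deriv2_sum (index_enum 'I_4)
  (fun j ij => deriv2_isqrt (@quadratic_dist2 collision_free i j)
     (fun w Dw => Dw.2 i j ij))).
apply: (deriv2_eq (H xpredT)) => //.
by apply/funext => z; do 2!apply: eq_bigr => ? _; rewrite div1r.
Qed.

Definition ddsqrt2IU z u v : R :=
  (isqrt (size2 z) * dot u v
   - isqrt (size2 z) ^+ 3 * dot z u * dot z v) * potential z
  + isqrt (size2 z) * dot z v * dpotential z u
  + isqrt (size2 z) * dot z u * dpotential z v
  + Num.sqrt (size2 z) * ddpotential z u v.

Lemma deriv2_sqrt2IU : exists df,
  deriv2_on collision_free (@sqrt2IU R) df ddsqrt2IU.
Proof.
have H := deriv2M
  (deriv2_sqrt (@quadratic_size2 collision_free) (fun w Dw => Dw.1))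
  deriv2_potential.
eexists; apply: (deriv2_eq H) => //.
by apply/funext => z; rewrite /sqrt2IU /inertia mulVKf.
Qed.

Lemma near_collision_free z :
  collision_free z -> \forall w \near z, collision_free w.
Proof.
have cx i : continuous (fun w => xpos w i : R) by exact: coord_continuous.
have cy i : continuous (fun w => ypos w i : R) by exact: coord_continuous.
have sqr (f : 'rV[R]_8 -> R) : continuous f -> continuous (fun w => f w ^+ 2).
  by move=> cf w; exact: cvgM (cf w) (cf w).
move=> [s0 d0]; apply: filterI.
  have cs : continuous size2.
    apply: continuous_big => [|i _ w]; first exact: add_continuous.
    exact: cvgD (sqr _ (cx i) w) (sqr _ (cy i) w).
  exact: cvgr_gt (cs z) _ s0.
suff near_ij (i j : 'I_4) :
    \forall w \near z, (i < j)%N -> 0 < dist2 i j w.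
  exact: (filter_forall _ (fun i => filter_forall _ (near_ij i))).
case: (boolP (i < j)%N) => [ij|nij]; last by near=> w.
have cd : continuous (dist2 i j).
  have dx w : {for w, continuous (fun w => xpos w i - xpos w j)}.
    exact: cvgB (cx i w) (cx j w).
  have dy w : {for w, continuous (fun w => ypos w i - ypos w j)}.
    exact: cvgB (cy i w) (cy j w).
  by move=> w; exact: cvgD (sqr _ dx w) (sqr _ dy w).
by near=> w => _; near: w; exact: cvgr_gt (cd z) _ (d0 i j ij).
Unshelve. all: by end_near. Qed.

End FourBodyDerivatives.

(** * Characteristic polynomial from an orthogonal family *)

Section Diagonalization.

(** The matrix [c^-1 *: P^T] is the inverse of [P], so the given matrix is similar
    to [diag_mx d].  With row [k] of [P] as [m_k], it is the sum over [k] of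
    [d_k / c] times the square of the linear form [m_k]. *)
Lemma char_poly_orthogonal_conj (F : fieldType) n (P : 'M[F]_n) (d : 'rV[F]_n)
    (c : F) : c != 0 -> P *m P^T = c%:M ->
  char_poly (P^T *m diag_mx (c^-1 *: d) *m P) = \prod_(i < n) ('X - (d 0 i)%:P).
Proof.
move=> c0 PPT.
pose Q := c^-1 *: P^T.
have QP : Q *m P = 1%:M.
  by apply: mulmx1C; rewrite -scalemxAr PPT scale_scalar_mx mulVf.
have -> : P^T *m diag_mx (c^-1 *: d) *m P = Q *m diag_mx d *m P.
  by rewrite linearZ /= -scalemxAr -!scalemxAl.
have charE : char_poly_mx (Q *m diag_mx d *m P) =
    map_mx polyC Q *m char_poly_mx (diag_mx d) *m map_mx polyC P.
  rewrite /char_poly_mx mulmxBr mulmxBl -!map_mxM; congr (_ - _).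
  by rewrite mul_mx_scalar -scalemxAl -map_mxM QP map_mx1 scalemx1.
rewrite /char_poly charE !det_mulmx mulrAC.
rewrite -det_mulmx -map_mxM QP map_mx1 det1 mul1r.
rewrite -/(char_poly _) char_poly_trig ?diag_mx_is_trig //.
by apply: eq_bigr => i _; rewrite mxE eqxx mulr1n.
Qed.

End Diagonalization.

(** * Evaluation at the square *)

Section SquareConfiguration.
Variable R : realType.
Implicit Types u v : 'rV[R]_8.

Notation z0 := (square_config R).

Lemma sum4 (F : 'I_4 -> R) : \sum_(i < 4) F i =
  F (inord 0) + F (inord 1) + F (inord 2) + F (inord 3).
Proof.
rewrite !big_ord_recl big_ord0 addr0 !addrA.
by do ![congr (_ + _)]; congr F; apply: val_inj; rewrite /= inordK.
Qed.

Lemma sum8 (F : 'I_8 -> R) : \sum_(i < 8) F i =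
  F (inord 0) + F (inord 1) + F (inord 2) + F (inord 3) +
  F (inord 4) + F (inord 5) + F (inord 6) + F (inord 7).
Proof.
rewrite !big_ord_recl big_ord0 addr0 !addrA.
by do ![congr (_ + _)]; congr F; apply: val_inj; rewrite /= inordK.
Qed.

Lemma sum_pairs4 (F : 'I_4 -> 'I_4 -> R) :
  \sum_(i < 4) \sum_(j < 4 | (i < j)%N) F i j =
  F (inord 0) (inord 1) + F (inord 0) (inord 2) + F (inord 0) (inord 3)
  + F (inord 1) (inord 2) + F (inord 1) (inord 3) + F (inord 2) (inord 3).
Proof.
under eq_bigr do rewrite big_mkcond sum4.
by rewrite sum4 !inordK //= !add0r !addr0 !addrA.
Qed.

Lemma posE (z : 'rV[R]_8) :
  ((xpos z (inord 0) = z 0 (inord 0)) * (ypos z (inord 0) = z 0 (inord 1)) *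
   (xpos z (inord 1) = z 0 (inord 2)) * (ypos z (inord 1) = z 0 (inord 3)) *
   (xpos z (inord 2) = z 0 (inord 4)) * (ypos z (inord 2) = z 0 (inord 5)) *
   (xpos z (inord 3) = z 0 (inord 6)) * (ypos z (inord 3) = z 0 (inord 7)))%type.
Proof. by rewrite /xpos /ypos !inordK. Qed.

Lemma square_configE k : (k < 8)%N ->
  z0 0 (inord k) = [:: 2; 0; 0; 2; -2; 0; 0; -2]`_k :> R.
Proof. by move=> k8; rewrite mxE inordK. Qed.

(** In order: dilation, rotation, rhombus and rectangle deformations, the two
    translations, and the two motions of the opposite pairs against each other.
    The rows are listed in the order of [eigenvalues]. *)
Definition modes : seq (seq R) := [::
  [:: 1; 0; 0; 1; -1; 0; 0; -1];
  [:: 0; 1; -1; 0; 0; -1; 1; 0];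
  [:: 1; 0; 0; -1; -1; 0; 0; 1];
  [:: 0; 1; 1; 0; 0; -1; -1; 0];
  [:: 1; 0; 1; 0; 1; 0; 1; 0];
  [:: 0; 1; 0; 1; 0; 1; 0; 1];
  [:: 1; 0; -1; 0; 1; 0; -1; 0];
  [:: 0; 1; 0; -1; 0; 1; 0; -1]].

Definition mode_mx : 'M[R]_8 := \matrix_(k, i) (nth [::] modes k)`_i.

Definition eigenvalues : seq R :=
  [:: 0; 0; 3 / 8; 3 * Num.sqrt 2 / 4;
      Num.sqrt 2 / 4 + 1 / 8; Num.sqrt 2 / 4 + 1 / 8;
      Num.sqrt 2 / 2 + 1 / 8; Num.sqrt 2 / 2 + 1 / 8].

Definition eigenvalue_row : 'rV[R]_8 := \row_k eigenvalues`_k.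

Lemma mode_mx_orthogonal : mode_mx *m mode_mx^T = 4%:M.
Proof.
apply/matrixP => k l; rewrite !mxE.
under eq_bigr do rewrite !mxE.
rewrite !big_ord_recl big_ord0 /=.
case: k => [[|[|[|[|[|[|[|[|//]]]]]]]] Hk];
case: l => [[|[|[|[|[|[|[|[|//]]]]]]]] Hl] /=; rewrite ?mulr1n ?mulr0n; ring.
Qed.

Lemma isqrt16 : isqrt (16 : R) = 1 / 4.
Proof.
by rewrite /isqrt (_ : 16 = 4 ^+ 2); [rewrite sqrtr_sqr ger0_norm // div1r|ring].
Qed.

Lemma isqrt8 : isqrt (8 : R) = Num.sqrt 2 / 4.
Proof.
have s2 : Num.sqrt 2 ^+ 2 = 2 :> R by rewrite sqr_sqrtr.
rewrite /isqrt (_ : 8 = 2 ^+ 2 * 2); last by ring.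
rewrite sqrtrM // sqrtr_sqr ger0_norm //.
have s0 : Num.sqrt 2 != 0 :> R by rewrite gt_eqF // sqrtr_gt0.
by apply: (mulfI s0); field: s2.
Qed.

Lemma size2_square : size2 z0 = 16.
Proof. by rewrite /size2 sum4 !posE !square_configE //=; ring. Qed.

Lemma dist2_square :
  ((dist2 (inord 0) (inord 1) z0 = 8) * (dist2 (inord 0) (inord 2) z0 = 16) *
   (dist2 (inord 0) (inord 3) z0 = 8) * (dist2 (inord 1) (inord 2) z0 = 8) *
   (dist2 (inord 1) (inord 3) z0 = 16) * (dist2 (inord 2) (inord 3) z0 = 8))%type.
Proof.
by do !split; rewrite /dist2 !posE !square_configE //=; ring.
Qed.

Lemma potential_square : potential z0 = Num.sqrt 2 + 1 / 2.
Proof.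
rewrite [LHS]sum_pairs4 -!/(dist2 _ _ _) !dist2_square !div1r.
by rewrite -!/(isqrt _) isqrt8 isqrt16; field.
Qed.

Lemma collision_free_square : collision_free z0.
Proof.
split=> [|i j]; first by rewrite size2_square.
have E (k : 'I_4) : k = inord k by rewrite inord_val.
rewrite (E i) (E j) !inordK //.
case: i => -[|[|[|[|//]]]] _ /=; case: j => -[|[|[|[|//]]]] _ //= _;
  by rewrite dist2_square.
Qed.

(** The spectral decomposition.  Once the powers of [isqrt 8] are reduced with
    [sqrt 2 ^ 2 = 2], both sides are affine in [sqrt 2], and the identity holds
    with [sqrt 2] replaced by an indeterminate. *)
Lemma ddsqrt2IU_square u v : ddsqrt2IU z0 u v = \sum_(k < 8)
  eigenvalues`_k / 4 * (mode_mx *m u^T) k 0 * (mode_mx *m v^T) k 0.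
Proof.
have s2 : Num.sqrt 2 ^+ 2 = 2 :> R by rewrite sqr_sqrtr.
have s8_3 : isqrt (8 : R) ^+ 3 = Num.sqrt 2 / 32 by rewrite isqrt8; field: s2.
have s8_5 : isqrt (8 : R) ^+ 5 = Num.sqrt 2 / 256 by rewrite isqrt8; field: s2.
have s16_3 : isqrt (16 : R) ^+ 3 = 1 / 64 by rewrite isqrt16; field.
have s16_5 : isqrt (16 : R) ^+ 5 = 1 / 1024 by rewrite isqrt16; field.
have s16 : Num.sqrt 16 = 4 :> R.
  by rewrite -[LHS]invrK -/(isqrt 16) isqrt16 div1r invrK.
rewrite /ddsqrt2IU potential_square /dpotential /ddpotential !sum_pairs4.
rewrite size2_square !dist2_square s8_3 s8_5 s16_3 s16_5 s16 isqrt16.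
rewrite /dot /reldot !sum4 !posE !square_configE // sum8 !mxE.
rewrite !sum8 !mxE !inordK //=.
move: (u 0 (inord 0)) (u 0 (inord 1)) (u 0 (inord 2)) (u 0 (inord 3))
  (u 0 (inord 4)) (u 0 (inord 5)) (u 0 (inord 6)) (u 0 (inord 7))
  (v 0 (inord 0)) (v 0 (inord 1)) (v 0 (inord 2)) (v 0 (inord 3))
  (v 0 (inord 4)) (v 0 (inord 5)) (v 0 (inord 6)) (v 0 (inord 7)).
move: (Num.sqrt 2) => s u0 u1 u2 u3 u4 u5 u6 u7 v0 v1 v2 v3 v4 v5 v6 v7.
by field.
Qed.

End SquareConfiguration.

Unset Implicit Arguments.

Theorem mainTheorem1 (R : realType) :
  has_hessian (@sqrt2IU R) (square_config R) /\
  char_poly (hessian (@sqrt2IU R) (square_config R)) =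
    \prod_(a <- [:: 0; 0; 3 / 8; 3 * Num.sqrt 2 / 4;
                    Num.sqrt 2 / 4 + 1 / 8; Num.sqrt 2 / 4 + 1 / 8;
                    Num.sqrt 2 / 2 + 1 / 8; Num.sqrt 2 / 2 + 1 / 8 : R])
      ('X - a%:P).
Proof.
have [df Df] := deriv2_sqrt2IU R.
have [hasH ->] := hessian_deriv2 Df (near_collision_free (collision_free_square R)).
split=> //.
have -> : \matrix_(i, j) ddsqrt2IU (square_config R) (basis_vec R i) (basis_vec R j)
    = (mode_mx R)^T *m diag_mx (4^-1 *: eigenvalue_row R) *m mode_mx R.
  apply/matrixP => i j; rewrite mxE ddsqrt2IU_square [RHS]mxE.
  apply: eq_bigr => k _; rewrite /basis_vec !trmx_delta -!colE mul_mx_diag !mxE.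
  by ring.
rewrite (char_poly_orthogonal_conj _ _ (mode_mx_orthogonal R)) ?pnatr_eq0 //.
rewrite [RHS](big_nth 0) big_mkord.
by apply: eq_bigr => k _; rewrite mxE.
Qed.
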